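(* Let $\lambda=(\lambda_1\ge\dots\ge\lambda_n\ge0)$ be a partition with at most $n$ parts, and let $\mathbf{x}=(x_1,\dots,x_n)$ and $\mathbf{t}=(t_1,\dots,t_n)$ be commuting indeterminates. Then $$G_\lambda(\mathbf{x};\mathbf{t})=\det\left[\sum_{k=0}^{\infty}e_{k-\lambda_i+i-j}(-t_1,\dots,-t_{i-1})\,h_k(\mathbf{x})\right]_{i,j=1}^{n}=\det\left[\sum_{k=0}^{\infty}e_k(-t_1,\dots,-t_{i-1})\,h_{k+\lambda_i-i+j}(\mathbf{x})\right]_{i,j=1}^{n}.$$
   Context: $h_k$ and $e_k$ are the complete homogeneous and elementary symmetric polynomials, with $h_0=e_0=1$, $h_k=e_k=0$ for $k<0$, and $e_k$ of the empty set of variables equal to $\delta_{k0}$. A (semistandard) set-valued tableau of shape $\lambda$ is a filling of the boxes of $\lambda$ (English convention, row 1 at the top) with finite non-empty sets of positive integers such that if box $B$ is immediately to the right of box $A$ then $\max A\le\min B$, and if box $C$ is immediately below box $A$ then $\max A<\min C$. Let $\mathrm{SVT}^n(\lambda)$ be the set of those with all entries at most $n$. For such $T$, let $e_i(T)$ be the number of extra entries in row $i$ (total number of integers in row $i$ minus the number of boxes in row $i$), and let $\mathbf{x}^T=\prod_k x_k^{c_k}$ where $c_k$ is the number of occurrences of $k$ in $T$. The refined Grothendieck polynomial is $G_\lambda(\mathbf{x};\mathbf{t}):=\sum_{T\in\mathrm{SVT}^n(\lambda)}\prod_i(-t_i)^{e_i(T)}\,\mathbf{x}^T$. *)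

(* Defs.v *)
From HB Require Import structures.
From mathcomp Require Import all_boot all_order all_algebra.
From mathcomp Require Import mpoly.
From mathcomp Require Import classical_sets fsbigop.

Set Implicit Arguments.
Unset Strict Implicit.
Unset Printing Implicit Defensive.

Import GRing.Theory.
Local Open Scope ring_scope.

(* Rows, columns and entries are numbered from 0: row i : 'I_n stands for row
   i + 1, and the entry k : 'I_n of a tableau stands for the integer k + 1. *)

Section SetValuedTableaux.
Variables (n : nat) (lam : 'I_n -> nat).

Definition box := {i : 'I_n & 'I_(lam i)}.
Definition brow (b : box) : nat := tag b.
Definition bcol (b : box) : nat := tagged b.

(* Only used on non-empty sets, where the default values 0 (for the maximum)
   and n (for the minimum) are irrelevant. *)
Definition smax (A : {set 'I_n}) : nat := (\max_(a in A) val a)%N.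
Definition smin (A : {set 'I_n}) : nat := \big[minn/n]_(a in A) val a.

Definition filling := {ffun box -> {set 'I_n}}.

Definition is_svt (T : filling) : bool :=
  [&& [forall b, T b != finset.set0],
      [forall b, forall c, (brow c == brow b) && (bcol c == (bcol b).+1) ==>
                           (smax (T b) <= smin (T c))%N]
    & [forall b, forall c, (bcol c == bcol b) && (brow c == (brow b).+1) ==>
                           (smax (T b) < smin (T c))%N]].

(* The subtraction does not truncate on set-valued tableaux, since their boxes
   are non-empty. *)
Definition extra (T : filling) (i : 'I_n) : nat :=
  (\sum_(b : box | tag b == i) #|T b| - lam i)%N.

Definition occ (T : filling) (k : 'I_n) : nat := #|[pred b : box | k \in T b]|.

End SetValuedTableaux.

(* The 2n indeterminates of {mpoly R[n + n]} are x_1, ..., x_n, t_1, ..., t_n. *)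
Section Polynomials.
Variable R : comNzRingType.

Definition xvar (n : nat) (i : 'I_n) : {mpoly R[n + n]} := 'X_(lshift n i).
Definition tvar (n : nat) (i : 'I_n) : {mpoly R[n + n]} := 'X_(rshift n i).

Definition refined_grothendieck (n : nat) (lam : 'I_n -> nat) :
    {mpoly R[n + n]} :=
  \sum_(T : filling lam | is_svt T)
    (\prod_(i < n) (- tvar i) ^+ extra T i) * \prod_(k < n) xvar k ^+ occ T k.

Definition hsym (m k : nat) : {mpoly R[m]} :=
  \sum_(a : 'X_{1..m < k.+1} | mdeg a == k) 'X_[a].

Definition esymz (m : nat) (z : int) : {mpoly R[m]} :=
  if z is Posz k then mesym m R k else 0.
Definition hsymz (m : nat) (z : int) : {mpoly R[m]} :=
  if z is Posz k then hsym m k else 0.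

(* h_z(x_1, ..., x_n) *)
Definition hx (n : nat) (z : int) : {mpoly R[n + n]} :=
  hsymz n z \mPo [tuple xvar l | l < n].

(* e_z(- t_1, ..., - t_i) in the first i variables; as rows are numbered from
   0, this is e_z(- t_1, ..., - t_{i-1}) for the row usually numbered i. *)
Definition et (n : nat) (i : 'I_n) (z : int) : {mpoly R[n + n]} :=
  esymz i z \mPo [tuple - tvar (widen_ord (ltnW (ltn_ord i)) l) | l < i].

End Polynomials.

(* Main.v *)
(* The tableaux with entries at most m + 1 are obtained from those with entries at most m by
   adding the entry m + 1 in a horizontal strip and in some row ends with no box below, so
   summing over them is multilinear in the rows of a determinant. Inserting the determinant
   for m variables, each row sum telescopes by means of
   h_k(x_1, ..., x_m) = h_k(x_1, ..., x_(m+1)) - x_(m+1) h_(k-1)(x_1, ..., x_(m+1))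
   into (1 - t_i x_(m+1)) times row i minus a multiple of row i + 1 of the determinant for
   m + 1 variables. In the latter, the generating function of the h_k turns the last column
   into x_(m+1)^(lambda_i - i + m + 1) prod_(l < i) (1 - t_l x_(m+1)), which these row operations
   annihilate except in its last entry; this gives the recursion up to the factor
   prod_(i <= m) (1 - t_i x_(m+1)), which is regular. *)

Require Import Defs.
From mathcomp Require Import all_boot all_order all_algebra.
From mathcomp Require Import perm mpoly.
From mathcomp Require Import zify ring.

(** * Polynomials acting on two-sided sequences by shifts *)

Section ShiftAction.
Set Implicit Arguments.
Unset Strict Implicit.
Import GRing.Theory.
Local Open Scope ring_scope.
Variable A : comNzRingType.
Implicit Types (p q : {poly A}) (u : int -> A) (z : int).

(* [{poly A}] acts on [int -> A], the indeterminate acting as the shift. *)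
Definition pact p u z : A := \sum_(k < size p) p`_k * u (z + k%:Z).

Lemma pact_widen p u z n : (size p <= n)%N ->
  pact p u z = \sum_(k < n) p`_k * u (z + k%:Z).
Proof.
move=> le_pn; rewrite /pact (big_ord_widen n (fun k => p`_k * u (z + k%:Z))) //.
rewrite big_mkcond /=; apply: eq_bigr => k _.
by case: ltnP => // le_pk; rewrite nth_default // mul0r.
Qed.

Lemma pact1 u z : pact 1 u z = u z.
Proof. by rewrite /pact size_poly1 big_ord1 coef1 mul1r addr0. Qed.

(** Shifts commute. This lets the column combinations in [x] pass through the sums in [t]. *)
Lemma pactC p q u z : pact p (pact q u) z = pact q (pact p u) z.
Proof.
rewrite /pact; under eq_bigr do rewrite big_distrr /=.
rewrite exchange_big /=; apply: eq_bigr => k _.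
rewrite big_distrr /=; apply: eq_bigr => l _.
by rewrite mulrCA -!addrA [k%:Z + _]addrC.
Qed.

Lemma pactMlin p a b u z :
  pact (p * (a%:P + b *: 'X)) u z = a * pact p u z + b * pact p u (z + 1).
Proof.
set q := _ + _.
have szq : (size q <= 2)%N.
  rewrite (leq_trans (size_polyD _ _)) // geq_max (leq_trans (size_polyC_leq1 _)) //=.
  by rewrite (leq_trans (size_scale_leq _ _)) // size_polyX.
rewrite (@pact_widen _ _ _ (size p).+1); last first.
  apply: leq_trans (size_polyMleq _ _) _; move: szq; lia.
rewrite (@pact_widen p u z (size p).+1) // big_distrr /=.
rewrite /(pact p u (z + 1)) big_distrr /= [X in _ = _ + X](_ : _ =
   \sum_(k < (size p).+1) (b * (p * 'X)`_k) * u (z + k%:Z)); last first.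
  rewrite big_ord_recl coefMX mulr0 mul0r add0r; apply: eq_bigr => k _.
  by rewrite coefMX /= -mulrA -addrA; congr (_ * (_ * u (_ + _))); lia.
rewrite -big_split /=; apply: eq_bigr => k _.
rewrite /q mulrDr coefD -scalerAr coefZ coefMC; ring.
Qed.

Lemma pact_prodlin (c d : nat -> A) n u z :
  pact (\prod_(k < n.+1) ((c k)%:P + d k *: 'X)) u z =
  c n * pact (\prod_(k < n) ((c k)%:P + d k *: 'X)) u z +
  d n * pact (\prod_(k < n) ((c k)%:P + d k *: 'X)) u (z + 1).
Proof. by rewrite big_ord_recr pactMlin. Qed.

Lemma pactB p (c : A) u v w z :
  (forall z, w z = u z - c * v z) -> pact p w z = pact p u z - c * pact p v z.
Proof.
move=> wE; rewrite /pact big_distrr -sumrB /=; apply: eq_bigr => k _.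
rewrite wE; ring.
Qed.

Lemma pact_shift p u z : pact p (fun z' => u (z' + 1)) z = pact p u (z + 1).
Proof. by apply: eq_bigr => k _; rewrite addrAC. Qed.

(** From [z] on, a geometric sequence is an eigenvector of the shift, so [p] acts as its value at
    the ratio. *)
Lemma pact_geom p (c : A) u z :
  (forall k : nat, u (z + k%:Z) = c ^+ k * u z) -> pact p u z = p.[c] * u z.
Proof.
by move=> uE; rewrite horner_coef big_distrl /=; apply: eq_bigr => k _; rewrite uE mulrA.
Qed.

End ShiftAction.

(** * Complete homogeneous polynomials and the entries of the determinant *)

Section Columns.
Set Implicit Arguments.
Unset Strict Implicit.
Import GRing.Theory.
Local Open Scope ring_scope.
Variables (A : comNzRingType) (x t : nat -> A).

(** This is [h_k(x_0, ..., x_(m-1))], with [a] the exponent of the last variable. Variables come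
    from a sequence so that their number can vary in inductions. *)
Fixpoint chsym (m k : nat) : A :=
  if m is m'.+1 then \sum_(a < k.+1) x m' ^+ a * chsym m' (k - a)
  else (k == 0)%:R.

Definition chsymz (m : nat) (z : int) : A := if z is Posz k then chsym m k else 0.

Lemma chsymz_neg m z : (z < 0)%R -> chsymz m z = 0.
Proof. by case: z. Qed.

Lemma chsymzS m z : chsymz m.+1 z = chsymz m z + x m * chsymz m.+1 (z - 1).
Proof.
case: z => [[|k]|k]; last by rewrite !chsymz_neg ?mulr0 ?addr0 //; lia.
  by rewrite /= big_ord1 expr0 mul1r mulr0 addr0.
rewrite [_ - 1](_ : _ = k%:Z); last by lia.
rewrite [LHS]big_ord_recl expr0 mul1r subn0; congr (_ + _).
rewrite [chsymz _ _]/= big_distrr; apply: eq_bigr => a _ /=.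
by rewrite exprS mulrA subSS.
Qed.

(** The coefficients of [tpoly i] are the [e_k(-t_0, ..., -t_(i-1))]; those of [xpoly] serve as
    multipliers for combining columns. *)
Definition tpoly i : {poly A} := \prod_(k < i) (1%:P + (- t k) *: 'X).
Definition xpoly i : {poly A} := \prod_(k < i) ((- x k)%:P + 1 *: 'X).

(* [sum_k e_k(-t_0, ..., -t_(i-1)) h_(k+z)(x_0, ..., x_(m-1))] *)
Definition rsym i m z : A := pact (tpoly i) (chsymz m) z.

Lemma rsym_rows i m z : rsym i.+1 m z = rsym i m z - t i * rsym i m (z + 1).
Proof. by rewrite /rsym /tpoly (pact_prodlin (fun=> 1) (fun k => - t k)) mul1r mulNr. Qed.

Lemma rsym_vars i m z : rsym i m z = rsym i m.+1 z - x m * rsym i m.+1 (z - 1).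
Proof.
rewrite /rsym (_ : pact _ _ (z - 1) =
   pact (tpoly i) (fun z' => chsymz m.+1 (z' - 1)) z); last first.
  by rewrite /pact; apply: eq_bigr => k _; rewrite addrAC.
by apply: pactB => z'; rewrite chsymzS; ring.
Qed.

Lemma pact_xpolyS m u z : pact (xpoly m.+1) u z =
  pact (xpoly m) u (z + 1) - x m * pact (xpoly m) u z.
Proof. by rewrite /xpoly (pact_prodlin (fun k => - x k) (fun=> 1)) mul1r mulNr addrC. Qed.

(** Each factor [Y - x_l] removes the variable [x_l] and shifts by one; what remains is [h] in no
    variables, a delta. *)
Lemma pact_xpoly_chsymz m z : pact (xpoly m) (chsymz m) z = chsymz 0 (z + m%:Z).
Proof.
elim: m z => [|m IHm] z; first by rewrite /xpoly big_ord0 pact1 addr0.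
rewrite pact_xpolyS -pact_shift.
transitivity (pact (xpoly m) (fun z' => chsymz m (z' + 1)) z).
  by apply/esym/pactB => z'; rewrite [in RHS]chsymzS addrK; ring.
by rewrite pact_shift IHm; congr (chsymz 0); lia.
Qed.

Lemma xpoly_monic m : xpoly m \is monic.
Proof.
by apply: monic_prod => k _; rewrite scale1r polyCN addrC monicXsubC.
Qed.

Lemma size_xpoly m : size (xpoly m) = m.+1.
Proof.
rewrite /xpoly; under eq_bigr do rewrite scale1r polyCN addrC.
by rewrite size_prod_XsubC /index_enum -enumT size_enum_ord.
Qed.

(* The generating function identity [H_(m+1)(Y) E_m(-Y) = 1 / (1 - x_m Y)]. *)
Lemma pact_xpoly_geom m k : pact (xpoly m) (chsymz m.+1) (k%:Z - m%:Z) = x m ^+ k.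
Proof.
(* Removing [x_m] as well would leave a delta, which amounts to a first-order recurrence with ratio
   [x_m]. *)
have step z : pact (xpoly m) (chsymz m.+1) (z + 1) =
    x m * pact (xpoly m) (chsymz m.+1) z + chsymz 0 (z + m.+1%:Z).
  by rewrite -pact_xpoly_chsymz pact_xpolyS; ring.
elim: k => [|k IHk].
  (* At [-(m+1)] all indices of [h] are negative, as [xpoly m] has degree [m]; only the delta
     contributes. *)
  rewrite (_ : 0%:Z - m%:Z = (- m.+1%:Z) + 1); last by lia.
  rewrite step [pact _ _ _]big1 ?mulr0 ?add0r ?addNr // => k _.
  rewrite chsymz_neg ?mulr0 //; have := ltn_ord k; move: (size_xpoly m); lia.
rewrite (_ : k.+1%:Z - m%:Z = (k%:Z - m%:Z) + 1); last by lia.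
rewrite step IHk exprS (_ : _ - _ + _ = k.+1%:Z); last by lia.
by rewrite addr0.
Qed.

(** After exchanging the actions, [xpoly m] turns [h] into powers of [x_m], on which [tpoly i] acts
    as its value at [x_m]. *)
Lemma pact_xpoly_rsym i m k : pact (xpoly m) (rsym i m.+1) (k%:Z - m%:Z) =
  \prod_(l < i) (1 - t l * x m) * x m ^+ k.
Proof.
rewrite /rsym pactC (@pact_geom _ _ (x m)) => [|l]; last first.
  rewrite -[_ - _ + _]/(k%:Z - m%:Z + l%:Z) (_ : _ + _ = (l + k)%:Z - m%:Z); last by lia.
  by rewrite !pact_xpoly_geom exprD.
rewrite pact_xpoly_geom /tpoly horner_prod; congr (_ * _); apply: eq_bigr => l _.
by rewrite !hornerE mulNr.
Qed.

(* Summation over the admissible number [k] of boxes left in row [i] and over the presence of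
   an extra entry in the last one of them. *)
Lemma rsym_row_sum i m (a b : nat) (c : int) : (b <= a)%N ->
  \sum_(b <= k < a.+1) x m ^+ (a - k) * rsym i m (k%:Z + c) +
  \sum_(b.+1 <= k < a.+1) x m ^+ (a - k) * (- t i * x m) * rsym i m (k%:Z + c) =
  (1 - t i * x m) * rsym i m.+1 (a%:Z + c)
  - x m ^+ (a - b).+1 * rsym i.+1 m.+1 (b%:Z - 1 + c).
Proof.
have tele b' : (b' <= a.+1)%N ->
    \sum_(b' <= k < a.+1) x m ^+ (a - k) * rsym i m (k%:Z + c) =
    rsym i m.+1 (a%:Z + c) - x m ^+ (a.+1 - b') * rsym i m.+1 (b'%:Z - 1 + c).
  move=> le_b'a.
  pose f k := x m ^+ (a.+1 - k) * rsym i m.+1 (k%:Z - 1 + c).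
  rewrite (@eq_big_nat _ _ _ _ _ _ (fun k => f k.+1 - f k)) => [|k /andP[_ lt_ka]].
    rewrite telescope_sumr // /f subnn expr0 mul1r; congr (rsym _ _ _ - _); lia.
  rewrite rsym_vars /f subSS (subSn (ltnSE lt_ka)) exprSr.
  rewrite (_ : k.+1%:Z - 1 + c = k%:Z + c); last by lia.
  by rewrite (_ : k%:Z - 1 + c = k%:Z + c - 1); [ring|lia].
move=> le_ba.
(* The second sum is [- t_i x_m] times a telescoping sum that starts one later; [rsym_rows] merges
   the two lower boundary terms. *)
under [X in _ + X]eq_bigr do rewrite mulrAC.
rewrite -big_distrl /= !tele ?(leq_trans le_ba) //= subSS rsym_rows.
rewrite subSn // exprS (_ : b.+1%:Z - 1 + c = b%:Z + c); last by lia.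
by rewrite (_ : b%:Z - 1 + c + 1 = b%:Z + c); [ring|lia].
Qed.

End Columns.

(** * The recursion of the determinant in the number of variables *)

Section Determinant.
Set Implicit Arguments.
Unset Strict Implicit.
Import GRing.Theory.
Local Open Scope ring_scope.
Variables (A : comNzRingType) (x t : nat -> A) (N : nat).
Implicit Types lam : nat -> nat.

(* The rows beyond the first [m] make the determinant vanish on partitions with more than
   [m] parts, for which there is no tableau with entries below [m]. *)
Definition jtmx m lam : 'M[A]_N := \matrix_(i, j)
  if (i < m)%N then rsym x t i m ((lam i)%:Z - i%:Z + j%:Z)
  else ((i == j) && (lam i == 0))%:R.

Lemma row0_det n (M : 'M[A]_n) i : (forall j, M i j = 0) -> \det M = 0.
Proof.
by move=> M0; rewrite (expand_det_row _ i) big1 // => j _; rewrite M0 mul0r.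
Qed.

Lemma eq_cofactor n (M M' : 'M[A]_n) i j :
  (forall i' j', i' != i -> j' != j -> M i' j' = M' i' j') ->
  cofactor M i j = cofactor M' i j.
Proof.
move=> eqM; congr (_ * \det _); apply/matrixP => k l.
by rewrite !mxE eqM // eq_sym neq_lift.
Qed.

(** The outcome of summing the rows of [jtmx m] over the inner shapes when [lam] has at most [m + 1]
    parts. Row [m] can hold only the entry [m], hence its single power of [x_m]. *)
Definition stepmx m lam : 'M[A]_N := \matrix_(i, j)
  if (i < m)%N then (1 - t i * x m) * rsym x t i m.+1 ((lam i)%:Z - i%:Z + j%:Z)
     - x m ^+ (lam i - lam i.+1).+1
       * rsym x t i.+1 m.+1 ((lam i.+1)%:Z - i.+1%:Z + j%:Z)
  else if i == m :> nat then x m ^+ lam m * (j == m :> nat)%:R else (i == j)%:R.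

(** Column operations [V] and row operations [B] on [jtmx m.+1 lam] clear column [m] outside row
    [m]. The remaining cofactor is that of [stepmx], whose row [m] vanishes outside column [m]. *)
Lemma det_stepmx m lam : (m < N)%N -> (forall i, (m < i)%N -> lam i = 0) ->
  (forall i, lam i.+1 <= lam i)%N ->
  \prod_(i < m) (1 - t i * x m) * \det (stepmx m lam) =
  \prod_(i < m) (1 - t i * x m) * \det (jtmx m.+1 lam).
Proof.
move=> lt_mN lam0 lam_dec; pose om := Ordinal lt_mN; set d := \prod_(i < m) _.
(* [xpoly x m] is monic of degree [m], so [V] is upper unitriangular. *)
pose V : 'M[A]_N := \matrix_(i, j) if j == om then (xpoly x m)`_i else (i == j)%:R.
have detV : \det V = 1.
  rewrite -det_tr det_trig.
    rewrite big1 // => i _; rewrite !mxE eqxx; case: eqP => // ->.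
    by have /monicP := xpoly_monic x m; rewrite lead_coefE size_xpoly.
  apply/is_trig_mxP => i j lt_ij; rewrite !mxE; case: eqP => [im|_].
    by rewrite nth_default // size_xpoly; move: lt_ij; rewrite im /=.
  by case: eqP => // ji; move: lt_ij; rewrite ji ltnn.
pose b i := x m ^+ (lam i - lam i.+1).+1.
(* [B] forms the same combinations of adjacent rows as [stepmx]; it is upper bidiagonal. *)
pose B : 'M[A]_N := \matrix_(i, j) if (i < m)%N
  then (1 - t i * x m) * (i == j)%:R - b i * (j == i.+1 :> nat)%:R
  else (i == j)%:R.
have detB : \det B = d.
  rewrite -det_tr det_trig; last first.
    apply/is_trig_mxP => i j lt_ij; rewrite !mxE.
    have -> : (j == i) = false by apply/eqP => ji; move: lt_ij; rewrite ji ltnn.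
    have -> : (i == j.+1 :> nat) = false by lia.
    by rewrite !mulr0 subr0; case: ifP.
  rewrite /d (big_ord_widen N (fun i => 1 - t i * x m) (ltnW lt_mN)) big_mkcond /=.
  rewrite [RHS]big_mkcond /=; apply: eq_bigr => i _; rewrite !mxE eqxx.
  have -> : (i == i.+1 :> nat) = false by lia.
  by case: ifP => _; rewrite ?(mulr1, mulr0, subr0).
set M := jtmx m.+1 lam; pose W := M *m V.
have WE i j : j != om -> W i j = M i j.
  move=> jm; rewrite mxE (bigD1 j) //= !mxE (negPf jm) eqxx mulr1 big1 ?addr0 //.
  by move=> k kj; rewrite !mxE (negPf jm) (negPf kj) mulr0.
have WEm (i : 'I_N) : (i <= m)%N ->
    W i om = \prod_(l < i) (1 - t l * x m) * x m ^+ (lam i + (m - i)).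
  move=> le_im; rewrite mxE -pact_xpoly_rsym.
  rewrite (@pact_widen _ _ _ _ N); last by rewrite size_xpoly.
  apply: eq_bigr => k _; rewrite !mxE ltnS le_im eqxx mulrC.
  congr (_ * rsym _ _ _ _ _); lia.
have WEm0 (i : 'I_N) : (m < i)%N -> W i om = 0.
  move=> lt_mi; rewrite mxE big1 // => k _; rewrite !mxE ltnS leqNgt lt_mi /=.
  rewrite eqxx; case: eqP => [<-|]; last by rewrite mul0r.
  by rewrite [_`_i]nth_default ?mulr0 // size_xpoly.
have BWE (i : 'I_N) (lt_im : (i < m)%N) (j : 'I_N) : (B *m W) i j =
    (1 - t i * x m) * W i j - b i * W (Ordinal (leq_ltn_trans lt_im lt_mN)) j.
  set i' := Ordinal _; rewrite mxE (bigD1 i) //= (bigD1 i') /=; last first.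
    by rewrite -val_eqE /= ; lia.
  rewrite big1 => [|k /andP[ki ki']].
    rewrite !mxE lt_im !eqxx -!val_eqE /=.
    rewrite (_ : (i == i.+1 :> nat) = false) ?(_ : (i.+1 == i :> nat) = false); try lia.
    by rewrite /= mulr0n; ring.
  rewrite mxE lt_im [i == k]eq_sym (negPf ki).
  by move: ki'; rewrite -val_eqE /= => /negPf->; rewrite !mulr0 subr0 mul0r.
have BWEid (i : 'I_N) j : (m <= i)%N -> (B *m W) i j = W i j.
  move=> le_mi; rewrite mxE (bigD1 i) //= [B i i]mxE ltnNge le_mi /= eqxx mul1r.
  rewrite big1 ?addr0 // => k ki.
  by rewrite !mxE ltnNge le_mi /= [i == k]eq_sym (negPf ki) mul0r.
have <- : \det (B *m W) = d * \det M.
  by rewrite !det_mulmx detB detV mulr1.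
rewrite (expand_det_col (B *m W) om) (bigD1 om) //= big1 ?addr0 => [|i im]; last first.
  have [lt_im|le_mi] := ltnP i m; last first.
    rewrite BWEid // WEm0 ?mul0r //.
    by rewrite ltn_neqAle le_mi andbT eq_sym.
  (* The two terms cancel: the exponent in [b i] makes up for the change of [lam i + (m - i)] from
     row [i] to the next. *)
  rewrite BWE // !WEm ?(ltnW lt_im) // big_ord_recr /= /b.
  rewrite (_ : (lam i + (m - i) = (lam i - lam i.+1).+1 + (lam i.+1 + (m - i.+1)))%N).
    by rewrite exprD; ring.
  by move: (lam_dec i); lia.
rewrite BWEid // WEm // subnn addn0 (expand_det_row (stepmx m lam) om).
rewrite (bigD1 om) //= big1 ?addr0 => [|j jm]; last first.
  by rewrite mxE ltnn eqxx -[(j == m :> nat)%N]/(j == om) (negPf jm) mulr0 mul0r.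
rewrite !mxE ltnn !eqxx mulr1 mulrA; congr (_ * _); apply: eq_cofactor => i j im jm.
rewrite mxE; case: ifP => [lt_im|/negbT ge_im].
  by rewrite BWE // !WE // !mxE !ltnS lt_im (ltnW lt_im).
have lt_mi : (m < i)%N by move: im ge_im; rewrite -val_eqE /=; lia.
rewrite -[(i == m :> nat)%N]/(i == om) (negPf im) BWEid ?(ltnW lt_mi) // WE //.
by rewrite [M i j]mxE ltnS leqNgt lt_mi /= (lam0 i lt_mi) eqxx andbT.
Qed.

(** The weight of the entries [m] in row [i] when [ks.1] boxes keep smaller entries and [ks.2] tells
    whether the last of these also gets [m]; such a box must have no box below. The value 0 on other
    pairs lets sums run over a full product. *)
Definition step_wt (C m : nat) lam (i : nat) (ks : 'I_C.+1 * bool) : A :=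
  if (lam i.+1 + ks.2 <= ks.1 <= lam i)%N
  then x m ^+ (lam i - ks.1) * (- t i * x m) ^+ ks.2 else 0.

Definition step_shape C (f : {ffun 'I_N -> 'I_C.+1 * bool}) (i : nat) : nat :=
  if insub i is Some i' then (f i').1 else 0%N.

Lemma step_shapeE C (f : {ffun 'I_N -> 'I_C.+1 * bool}) (i : 'I_N) :
  step_shape f i = (f i).1.
Proof. by rewrite /step_shape valK. Qed.

(** Multilinearity in the rows, by distributing the products in the Leibniz expansion. *)
Lemma det_sum_rows (K : finType) (c : 'I_N -> K -> A) (r : 'I_N -> K -> 'I_N -> A) :
  \sum_(f : {ffun 'I_N -> K})
     (\prod_i c i (f i)) * \det (\matrix_(i, j) r i (f i) j) =
  \det (\matrix_(i, j) \sum_k c i k * r i k j).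
Proof.
rewrite [RHS]/(\det _); under eq_bigr do rewrite /(\det _) big_distrr /=.
rewrite exchange_big /=; apply: eq_bigr => s _.
rewrite [in RHS](eq_bigr (fun i => \sum_k c i k * r i k (s i))); last first.
  by move=> i _; rewrite mxE.
rewrite bigA_distr_bigA big_distrr /=; apply: eq_bigr => f _.
rewrite big_split /= mulrCA; congr (_ * (_ * _)).
by apply: eq_bigr => i _; rewrite mxE.
Qed.

Lemma sum_step_wt C m lam i (g : nat -> A) : (lam i <= C)%N -> (lam i.+1 <= lam i)%N ->
  \sum_(ks : 'I_C.+1 * bool) step_wt m lam i ks * g ks.1 =
  \sum_(lam i.+1 <= k < (lam i).+1) x m ^+ (lam i - k) * g k +
  \sum_((lam i.+1).+1 <= k < (lam i).+1) x m ^+ (lam i - k) * (- t i * x m) * g k.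
Proof.
move=> le_lamC lam_dec.
have conv a (h : nat -> A) : \sum_(a <= k < (lam i).+1) h k =
    \sum_(k < C.+1) if (a <= k <= lam i)%N then h k else 0.
  rewrite (@big_nat_widen _ _ _ a _ C.+1) // big_geq_mkord big_mkcond /=.
  by apply: eq_bigr => k _; rewrite ltnS andbC.
rewrite !conv -big_split.
rewrite -(pair_big xpredT xpredT (fun k s => step_wt m lam i (k, s) * g k)) /=.
apply: eq_bigr => k _; rewrite big_bool /step_wt /= addn0 addn1 [LHS]addrC.
by congr (_ + _); case: ifP; rewrite ?mul0r // ?mulr1.
Qed.

(** This serves the rows from [m] on. With no box kept there is none to carry an extra entry, so
    only the pair [(0, false)] counts. *)
Lemma sum_step_wt0 C m lam i :
  \sum_(ks : 'I_C.+1 * bool) step_wt m lam i ks * (ks.1 == 0 :> nat)%:R =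
  if lam i.+1 == 0%N then x m ^+ lam i else 0.
Proof.
rewrite (bigD1 (ord0, false)) //= big1 => [|[k s] /=].
  by rewrite addr0 mulr1 /step_wt /= addn0 leqn0 andbT subn0 mulr1.
case: (k =P 0%N :> nat) => [k0|_]; last by rewrite mulr0.
have -> : k = ord0 by apply/val_inj.
by case: s; rewrite ?eqxx //= /step_wt /= leqn0 addn1 mul0r.
Qed.

Lemma jtmx_rec C m lam : (m < N)%N -> (forall i, (N <= i)%N -> lam i = 0) ->
  (forall i, lam i.+1 <= lam i)%N -> (forall i, lam i <= C)%N ->
  \prod_(i < m) (1 - t i * x m) *
    (\sum_(f : {ffun 'I_N -> 'I_C.+1 * bool})
       (\prod_(i < N) step_wt m lam i (f i)) * \det (jtmx m (step_shape f))) =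
  \prod_(i < m) (1 - t i * x m) * \det (jtmx m.+1 lam).
Proof.
move=> lt_mN lam0 lam_dec le_lamC; pose om := Ordinal lt_mN.
pose r (i : 'I_N) (ks : 'I_C.+1 * bool) (j : 'I_N) : A :=
  if (i < m)%N then rsym x t i m ((ks.1)%:Z - i%:Z + j%:Z)
  else ((i == j) && (ks.1 == 0 :> nat))%:R.
transitivity (\prod_(i < m) (1 - t i * x m) *
    \det (\matrix_(i < N, j < N) \sum_k step_wt m lam i k * r i k j)).
  rewrite -det_sum_rows; congr (_ * _); apply: eq_bigr => f _; congr (_ * \det _).
  by apply/matrixP => i j; rewrite !mxE step_shapeE.
have rE (i j : 'I_N) : (m <= i)%N -> \sum_k step_wt m lam i k * r i k j =
    (i == j)%:R * (if lam i.+1 == 0%N then x m ^+ lam i else 0).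
  move=> le_mi; rewrite -(sum_step_wt0 C) big_distrr /=; apply: eq_bigr => k _.
  by rewrite /r ltnNge le_mi /= -mulnb natrM mulrCA.
(* With at most [m + 1] parts the row sums form [stepmx]; otherwise row [m] on the left and row
   [m + 1] on the right vanish. *)
case: (lam m.+1 =P 0%N) => [lamm0|/eqP lamm].
  have lam0' i : (m < i)%N -> lam i = 0%N.
    elim: i => // i IHi; rewrite ltnS leq_eqVlt => /orP[/eqP<-//|/IHi lami].
    by apply/eqP; rewrite -leqn0 -lami.
  rewrite -det_stepmx //; congr (_ * \det _); apply/matrixP => i j; rewrite !mxE.
  case: ltnP => [lt_im|le_mi].
    pose g k := rsym x t i m (k%:Z + (j%:Z - i%:Z)).
    rewrite (eq_bigr (fun ks => step_wt m lam i ks * g ks.1)); last first.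
      by move=> ks _; rewrite /r lt_im /g addrA addrAC.
    rewrite sum_step_wt // rsym_row_sum //; congr (_ * rsym _ _ _ _ _ - _ * rsym _ _ _ _ _); lia.
  rewrite rE // (lam0' i.+1) // eqxx; case: (nat_of_ord i =P m) => [im|im].
    by rewrite -im [RHS]mulrC [in RHS]eq_sym.
  by rewrite lam0' ?mulr1 //; lia.
congr (_ * _); rewrite [LHS](@row0_det _ _ om) => [|j]; last first.
  by rewrite mxE rE // (negPf lamm) mulr0.
have lt_m1N : (m.+1 < N)%N.
  by rewrite ltnNge; apply: contra lamm => /lam0->.
rewrite (@row0_det _ _ (Ordinal lt_m1N)) // => j.
by rewrite mxE ltnn /= (negPf lamm) andbF.
Qed.

End Determinant.

(** * Set-valued tableaux in a rectangle and removal of the largest entry *)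

Section Tableaux.
Set Implicit Arguments.
Unset Strict Implicit.
Import GRing.Theory.
Local Open Scope ring_scope.
Variables (A : comNzRingType) (x t : nat -> A) (N C : nat).
Implicit Types lam : nat -> nat.

(* Tableaux of all shapes inside an [N] by [C] rectangle share one type: the boxes outside
   the shape are those that carry the empty set. *)
Definition rfilling := {ffun 'I_N * 'I_C -> {set 'I_N}}.
Implicit Types T : rfilling.

(** Comparing entry by entry avoids maxima and minima of empty boxes. *)
Definition fits m lam T : bool :=
  [forall i : 'I_N, forall j : 'I_C,
    [&& (T (i, j) != set0) == (j < lam i)%N,
        [forall a in T (i, j), a < m]%N,
        [forall j' : 'I_C, (j' == j.+1 :> nat) ==>
           [forall a in T (i, j), forall b in T (i, j'), a <= b]%N]
      & [forall i' : 'I_N, (i' == i.+1 :> nat) ==>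
           [forall a in T (i, j), forall b in T (i', j), a < b]%N]]].

Lemma fitsP m lam T : reflect
  [/\ forall i j, (T (i, j) != set0) = (j < lam i)%N,
      forall i j a, a \in T (i, j) -> (a < m)%N,
      forall (i : 'I_N) (j j' : 'I_C) a b, j' = j.+1 :> nat ->
        a \in T (i, j) -> b \in T (i, j') -> (a <= b)%N
    & forall (i i' : 'I_N) (j : 'I_C) a b, i' = i.+1 :> nat ->
        a \in T (i, j) -> b \in T (i', j) -> (a < b)%N]
  (fits m lam T).
Proof.
apply: (iffP idP) => [fitT|[shT boundT rowT colT]].
  have {}fitT i j := forallP (forallP fitT i) j.
  split=> [i j|i j a aT|i j j' a b jj' aT bT|i i' j a b ii' aT bT];
    have /and4P[/eqP shT boundT rowT colT] := fitT i j => //.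
  - exact: (forall_inP boundT).
  - by move: rowT => /forallP/(_ j')/implyP/(_ (introT eqP jj'))/forall_inP/(_ a aT)
      /forall_inP/(_ b bT).
  - by move: colT => /forallP/(_ i')/implyP/(_ (introT eqP ii'))/forall_inP/(_ a aT)
      /forall_inP/(_ b bT).
apply/forallP => i; apply/forallP => j; apply/and4P; split.
- by rewrite shT.
- by apply/forall_inP => a; apply: boundT.
- apply/forallP => j'; apply/implyP => /eqP jj'; apply/forall_inP => a aT.
  by apply/forall_inP => b bT; apply: rowT jj' aT bT.
- apply/forallP => i'; apply/implyP => /eqP ii'; apply/forall_inP => a aT.
  by apply/forall_inP => b bT; apply: colT ii' aT bT.
Qed.

Arguments fitsP {m lam T}.

(** By the truncated predecessor the empty set weighs 1, so boxes outside the shape do not count. *)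
Definition box_wt (i : nat) (S : {set 'I_N}) : A :=
  (- t i) ^+ #|S|.-1 * \prod_(a in S) x a.

Definition rfill_wt T : A := \prod_(b : 'I_N * 'I_C) box_wt b.1 (T b).

Definition svt_sum m lam : A := \sum_(T | fits m lam T) rfill_wt T.

Definition rshape T (i : 'I_N) : nat := #|[set j | T (i, j) != set0]|.

Lemma rshape_le T i : (rshape T i <= C)%N.
Proof. by rewrite -[C in leqRHS]card_ord; apply: max_card. Qed.

(** A set closed under predecessors is an initial segment; cardinalities are compared with those of
    such segments. *)
Lemma card_downset (P : pred 'I_C) : (forall j j' : 'I_C, j' = j.+1 :> nat -> P j' -> P j) ->
  forall j, P j = (j < #|[set j | P j]|)%N.
Proof.
move=> Pdown.
have down k (j j' : 'I_C) : j' = (j + k)%N :> nat -> P j' -> P j.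
  elim: k j' => [|k IHk] j' jj'; first by have -> : j = j' by apply: val_inj; rewrite /= jj' addn0.
  have lt_jkC : (j + k < C)%N by have := ltn_ord j'; lia.
  move=> /(Pdown (Ordinal lt_jkC)) Pjk; apply: (IHk (Ordinal lt_jkC)) => //.
  by apply: Pjk; rewrite /= jj' addnS.
have card_init n : (n <= C)%N -> #|[set k : 'I_C | (k < n)%N]| = n.
  move=> le_nC; rewrite cardsE -sum1_card -[RHS]card_ord -sum1_card.
  by rewrite (big_ord_widen C (fun=> 1%N)).
move=> j; apply/idP/idP => [Pj|].
  rewrite -(card_init j.+1) //; apply: subset_leq_card; apply/subsetP => k.
  by rewrite !inE ltnS => le_kj; apply: (down (j - k)%N) Pj; rewrite /= subnKC.
apply: contraLR => nPj; rewrite -leqNgt -[leqRHS](card_init j) ?(ltnW (ltn_ord j)) //.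
apply: subset_leq_card; apply/subsetP => k; rewrite !inE => Pk.
by rewrite ltnNge; apply: contra nPj => le_jk; apply: (down (k - j)%N) Pk; rewrite /= subnKC.
Qed.

Variable m : nat.
Hypothesis lt_mN : (m < N)%N.
Let om := Ordinal lt_mN.

Definition restr T : rfilling := [ffun b => [set a in T b | (a < m)%N]].

Definition profile := {ffun 'I_N -> 'I_C.+1 * bool}.
Implicit Type f : profile.

(* In row [i], the boxes with an entry below [m] are counted by the first component, and the
   second one records whether the last of them contains [m]. *)
Definition cut T : profile * rfilling :=
  ([ffun i => (inord (rshape (restr T) i),
     [exists j : 'I_C, (j.+1 == rshape (restr T) i) && (om \in T (i, j))])], restr T).

Definition new_box (ks : 'I_C.+1 * bool) (l j : nat) : bool :=
  (ks.1 <= j < l)%N || (ks.2 && (j.+1 == ks.1 :> nat)).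

Definition glue lam (p : profile * rfilling) : rfilling :=
  [ffun b => p.2 b :|: (if new_box (p.1 b.1) (lam b.1) b.2 then [set om] else set0)].

(** The added boxes form a horizontal strip, and a row end that gets an extra entry has no box
    below. These are the profiles on which [step_wt] avoids its zero branch in every row. *)
Definition interlacing lam f : bool :=
  [forall i : 'I_N, lam i.+1 + (f i).2 <= (f i).1 <= lam i]%N.

Lemma in_restr T b a : (a \in restr T b) = (a \in T b) && (a < m)%N.
Proof. by rewrite ffunE inE. Qed.

Lemma in_glue lam p i j a : (a \in glue lam p (i, j)) =
  (a \in p.2 (i, j)) || (new_box (p.1 i) (lam i) j && (a == om)).
Proof. by rewrite ffunE inE /=; case: ifP; rewrite !inE. Qed.

(** * Removing the entry [m] from a tableau *)

Section Cut.
Variables (lam : nat -> nat) (T : rfilling).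
Hypotheses (lam_dec : forall i, (lam i.+1 <= lam i)%N) (fitT : fits m.+1 lam T)
  (le_lamC : forall i, (lam i <= C)%N) (lam0 : forall i, (N <= i)%N -> lam i = 0%N).

Let mu i := rshape (restr T) i.

(** Rows increase weakly, so the boxes that keep an entry below [m] form an initial segment of each
    row. *)
Lemma restr_shape i j : (restr T (i, j) != set0) = (j < mu i)%N.
Proof.
have [shT boundT rowT colT] := fitsP fitT.
rewrite /mu /rshape -(@card_downset (fun j => restr T (i, j) != set0)) // => {}j j' jj'.
case/set0Pn => b; rewrite in_restr => /andP[bT lt_bm].
have lt_j'lam : (j' < lam i)%N by rewrite -shT; apply/set0Pn; exists b.
have : T (i, j) != set0 by rewrite shT (leq_trans _ lt_j'lam) // jj'.
case/set0Pn => a aT; apply/set0Pn; exists a.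
by rewrite in_restr aT (leq_ltn_trans (rowT _ _ _ _ _ jj' aT bT)).
Qed.

Lemma cut_mem i (j : 'I_C) : (j < mu i)%N -> exists2 a, a \in T (i, j) & (a < m)%N.
Proof. by rewrite -restr_shape => /set0Pn[a]; rewrite in_restr => /andP[]; exists a. Qed.

Lemma cut_shapeE i : ((cut T).1 i).1 = mu i :> nat.
Proof. by rewrite ffunE /= inordK // ltnS rshape_le. Qed.

Lemma cut_extraE i :
  ((cut T).1 i).2 = [exists j : 'I_C, (j.+1 == mu i) && (om \in T (i, j))].
Proof. by rewrite ffunE. Qed.

Lemma cutK : glue lam (cut T) = T.
Proof.
have [shT boundT rowT colT] := fitsP fitT.
apply/ffunP => -[i j]; apply/setP => a; rewrite in_glue [(cut T).2]/= in_restr.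
have [lt_am|le_ma] := ltnP a m.
  by rewrite andbT (_ : (a == om) = false) ?andbF ?orbF // -val_eqE /=; lia.
rewrite andbF orFb; case: (a =P om) => [-> {a le_ma}|am]; last first.
  rewrite andbF; apply/esym/negbTE/negP => /boundT; move/eqP: am; rewrite -val_eqE /=; lia.
rewrite andbT /new_box cut_shapeE cut_extraE.
apply/idP/idP => [/orP[/andP[le_mu lt_lam]|/andP[/existsP[j' /andP[/eqP j'mu omT]] /eqP jmu]]|omT].
(* A box of [lam] beyond the inner shape is non-empty without an entry below [m], so it contains
   [m]. *)
- have : T (i, j) != set0 by rewrite shT.
  case/set0Pn => a aT; have := boundT _ _ _ aT; rewrite ltnS leq_eqVlt => /orP[/eqP am|lt_am].
    by have -> : om = a by apply: val_inj; rewrite /= am.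
  have : restr T (i, j) != set0 by apply/set0Pn; exists a; rewrite in_restr aT.
  by rewrite restr_shape ltnNge le_mu.
- by have -> : j = j' by apply: val_inj => /=; lia.
have -> : (j < lam i)%N by rewrite -shT; apply/set0Pn; exists om.
case: leqP => //= lt_jmu; apply/andP; suff jmu : j.+1 = mu i.
  by split; [apply/existsP; exists j; rewrite jmu eqxx | rewrite jmu].
(* A further inner box to the right would have an entry below [m], against the row condition. *)
apply/eqP; rewrite eqn_leq lt_jmu leqNgt; apply/negP => lt_j1mu.
have lt_j1C : (j.+1 < C)%N := leq_trans lt_j1mu (rshape_le _ _).
have [b bT lt_bm] := @cut_mem i (Ordinal lt_j1C) lt_j1mu.
by have := rowT _ _ _ _ _ (erefl : Ordinal lt_j1C = j.+1 :> nat) omT bT; rewrite leqNgt lt_bm.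
Qed.

(** Columns increase strictly, so a box with a box below it has only entries below [m]: it is kept
    and does not contain [m]. *)
Lemma cut_interlacing : interlacing lam (cut T).1.
Proof.
have [shT boundT rowT colT] := fitsP fitT.
have above (i i' : 'I_N) (j : 'I_C) : i' = i.+1 :> nat -> (j < lam i')%N ->
    (j < mu i)%N /\ om \notin T (i, j).
  move=> ii' lt_jlam; have := lt_jlam; rewrite -shT => /set0Pn[b bT].
  have lt_abm a : a \in T (i, j) -> (a < m)%N.
    by move=> aT; apply: leq_trans (colT _ _ _ _ _ ii' aT bT) _; apply: (boundT _ _ _ bT).
  split; last by apply/negP => /lt_abm; rewrite ltnn.
  have : T (i, j) != set0 by rewrite shT (leq_trans lt_jlam) // ii'.
  by case/set0Pn => a aT; rewrite -restr_shape; apply/set0Pn; exists a; rewrite in_restr aT lt_abm.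
apply/forallP => i; rewrite cut_shapeE cut_extraE; apply/andP; split; last first.
  case E: (mu i) => [|k] //.
  have lt_kC : (k < C)%N by rewrite -E rshape_le.
  have := @cut_mem i (Ordinal lt_kC); rewrite E => /(_ (ltnSn k))[a aT _].
  by rewrite -(shT i (Ordinal lt_kC)); apply/set0Pn; exists a.
have [lt_i1N|le_Ni1] := ltnP i.+1 N; last first.
  rewrite lam0 // add0n; case: existsP => // -[j /andP[/eqP<-]] //.
have le_lammu : (lam i.+1 <= mu i)%N.
  case E: (lam i.+1) => [|k] //.
  have lt_kC : (k < C)%N by rewrite -E le_lamC.
  by have [] := above i (Ordinal lt_i1N) (Ordinal lt_kC) erefl; rewrite /= ?E.
case: existsP => [[j /andP[/eqP jmu omT]]|_]; last by rewrite addn0.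
rewrite addn1 ltn_neqAle le_lammu andbT; apply/eqP => lammu.
have [] := above i (Ordinal lt_i1N) j erefl; first by rewrite /= lammu -jmu.
by rewrite omT.
Qed.

Lemma cut_fits : fits m (step_shape (cut T).1) (restr T).
Proof.
have [shT boundT rowT colT] := fitsP fitT.
apply/fitsP; split=> [i j|i j a|i j j' a b jj'|i i' j a b ii'];
  rewrite ?in_restr.
- by rewrite restr_shape step_shapeE cut_shapeE.
- by case/andP.
- by case/andP=> aT _ /andP[bT _]; apply: rowT jj' aT bT.
- by case/andP=> aT _ /andP[bT _]; apply: colT ii' aT bT.
Qed.

End Cut.

(** * Adding the entry [m] to a tableau *)

Section Glue.
Variables (lam : nat -> nat) (f : profile) (T : rfilling).
Hypotheses (lam_f : interlacing lam f) (fitT : fits m (step_shape f) T).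

Let mem_lt i j a : a \in T (i, j) -> (j < (f i).1)%N.
Proof.
have [shT _ _ _] := fitsP fitT.
by move=> aT; rewrite -step_shapeE -shT; apply/set0Pn; exists a.
Qed.

Lemma glue_fits : fits m.+1 lam (glue lam (f, T)).
Proof.
have [shT boundT rowT colT] := fitsP fitT.
have inter i := andP (forallP lam_f i).
have shG i j : (glue lam (f, T) (i, j) != set0) = (j < lam i)%N.
  have [le_lamf le_flam] := inter i.
  apply/set0Pn/idP => [[a]|lt_jlam].
    rewrite in_glue /new_box /= => /orP[/mem_lt lt_jf|/andP[/orP[/andP[]//|/andP[_ /eqP jf]] _]].
      exact: leq_trans lt_jf le_flam.
    by rewrite jf.
  have [le_fj|] := leqP (f i).1 j.
    by exists om; rewrite in_glue /new_box /= le_fj lt_jlam eqxx orbT.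
  by rewrite -step_shapeE -shT => /set0Pn[a aT]; exists a; rewrite in_glue aT.
apply/fitsP; split=> // [i j a|i j j' a b jj'|i i' j a b ii'].
- by rewrite in_glue /= => /orP[/boundT/ltnW//|/andP[_ /eqP->]].
- rewrite !in_glue /= => aG /orP[bT|/andP[_ /eqP->]]; last first.
    by case/orP: aG => [/boundT/ltnW//|/andP[_ /eqP->]].
  case/orP: aG => [aT|/andP[newj _]]; first exact: rowT jj' aT bT.
  by have := mem_lt bT; move: newj; rewrite /new_box jj'; lia.
- move=> aG bG; have lt_jlam : (j < lam i.+1)%N.
    by rewrite -ii' -shG; apply/set0Pn; exists b.
  have [le_lamf le_flam] := inter i.
  (* Since there is a box below, interlacing excludes a new entry [m] here. *)
  have aT : a \in T (i, j).
    move: aG; rewrite in_glue /= => /orP[//|/andP[newj _]].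
    by move: newj le_lamf; rewrite /new_box; case: (f i).2 => /=; lia.
  move: bG; rewrite in_glue /= => /orP[bT|/andP[_ /eqP->]]; first exact: colT ii' aT bT.
  exact: boundT aT.
Qed.

Lemma glueK : cut (glue lam (f, T)) = (f, T).
Proof.
have [shT boundT _ _] := fitsP fitT.
have rG : restr (glue lam (f, T)) = T.
  apply/ffunP => -[i j]; apply/setP => a; rewrite in_restr in_glue /=.
  have [lt_am|le_ma] := ltnP a m.
    by rewrite andbT (_ : (a == om) = false) ?andbF ?orbF // -val_eqE /=; lia.
  by rewrite andbF; apply/esym/negbTE/negP => /boundT; rewrite ltnNge le_ma.
have shE i : rshape T i = (f i).1.
  rewrite /rshape -[RHS]card_ord -sum1_card -[RHS]sum1_card (big_ord_widen C (fun=> 1%N)).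
    by apply: eq_bigl => j; rewrite inE shT step_shapeE.
  by rewrite -ltnS ltn_ord.
rewrite /cut rG; congr (_, _); apply/ffunP => i; rewrite ffunE shE.
rewrite [RHS]surjective_pairing; congr (_, _); first by rewrite inord_val.
have /andP[le_lamf _] := forallP lam_f i.
apply/existsP/idP => [[j /andP[/eqP jf]]|fi].
  rewrite in_glue /new_box /= eqxx -jf leqNgt ltnSn eqxx /= !andbT => /orP[/boundT|//].
  by rewrite ltnn.
have lt_C : ((f i).1.-1 < C)%N.
  by have := ltn_ord (f i).1; move: le_lamf; rewrite fi; lia.
have predK : (f i).1.-1.+1 = (f i).1 by move: le_lamf; rewrite fi; lia.
by exists (Ordinal lt_C); rewrite in_glue /new_box /= predK fi !eqxx !orbT.
Qed.

(** In an empty box the new [m] is no extra entry and brings [x_m]; in a non-empty one it is extra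
    and brings [- t_i x_m]. *)
Lemma box_wt_glue (i : 'I_N) (j : 'I_C) : box_wt i (glue lam (f, T) (i, j)) = box_wt i (T (i, j)) *
  ((if ((f i).1 <= j < lam i)%N then x m else 1) *
   (if (f i).2 && (j.+1 == (f i).1 :> nat) then - t i * x m else 1)).
Proof.
have [shT boundT _ _] := fitsP fitT.
have omT b : om \notin T b by case: b => i' j'; apply/negP => /boundT; rewrite ltnn.
have card_or0 : (T (i, j) == set0) = ((f i).1 <= j)%N.
  by rewrite -[LHS]negbK shT step_shapeE -leqNgt.
rewrite ffunE /= /new_box; case: (ltnP j (f i).1) card_or0 => [lt_jf|le_fj] /=.
  move=> T0; case: ifP => _; last by rewrite setU0 !mulr1.
  rewrite setUC /box_wt cardsU1 omT add1n /= big_setU1 ?omT //= mul1r.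
  have : (0 < #|T (i, j)|)%N by rewrite card_gt0 T0.
  by case: #|_| => // k _; rewrite exprS; ring.
move/eqP->; rewrite (_ : (j.+1 == (f i).1 :> nat) = false); last by lia.
rewrite andbF orbF; case: ifP => _; last by rewrite setU0 !mulr1.
by rewrite set0U /box_wt cards1 cards0 big_set1 big_set0 !mulr1 !mul1r.
Qed.

Lemma rfill_wt_glue : (forall i, (lam i <= C)%N) ->
  rfill_wt (glue lam (f, T)) = (\prod_(i < N) step_wt x t m lam i (f i)) * rfill_wt T.
Proof.
move=> le_lamC.
have split_wt S : rfill_wt S = \prod_(i < N) \prod_(j < C) box_wt i (S (i, j)).
  by rewrite pair_big /=; apply: eq_bigr => -[].
rewrite !split_wt -big_split; apply: eq_bigr => i _ /=.
under eq_bigr do rewrite box_wt_glue.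
rewrite !big_split /= mulrC; congr (_ * _).
have /andP[le_lamf le_flam] := forallP lam_f i.
rewrite /step_wt le_lamf le_flam; congr (_ * _).
  rewrite -big_mkcond /= (eq_bigl (fun j : 'I_C => (j < lam i) && ((f i).1 <= j)))%N; last first.
    by move=> j; rewrite andbC.
  rewrite -(big_geq_mkord _ _ (fun j => j < lam i)%N (fun=> x m)).
  by rewrite -(@big_nat_widen _ _ _ _ _ _ predT) // big_const_nat iter_mulr_1.
case fi: (f i).2 => /=; last by rewrite big1_eq.
have lt_C : ((f i).1.-1 < C)%N.
  by have := ltn_ord (f i).1; move: le_lamf; rewrite fi; lia.
rewrite (bigD1 (Ordinal lt_C)) //= ifT; last by move: le_lamf; rewrite fi; lia.
rewrite big1 ?mulr1 // => j; rewrite -val_eqE /= => jf; rewrite ifF //.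
by move: jf le_lamf; rewrite fi; lia.
Qed.

End Glue.

(** [cut] and [glue] are mutually inverse between tableaux and pairs of an interlacing profile and a
    smaller tableau; the other profiles have weight 0. *)
Lemma svt_sum_rec lam : (forall i, (lam i.+1 <= lam i)%N) -> (forall i, (lam i <= C)%N) ->
  (forall i, (N <= i)%N -> lam i = 0%N) ->
  svt_sum m.+1 lam = \sum_(f : profile)
    (\prod_(i < N) step_wt x t m lam i (f i)) * svt_sum m (step_shape f).
Proof.
move=> lam_dec le_lamC lam0; rewrite /svt_sum (reindex_onto (glue lam) cut); last first.
  by move=> T fitT; rewrite cutK.
under [RHS]eq_bigr do rewrite big_distrr /=.
rewrite pair_big_dep /= [RHS](bigID (fun p => interlacing lam p.1)) /=.
rewrite [X in _ + X]big1 ?addr0 => [|[f T] /= /andP[_]]; last first.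
  rewrite negb_forall => /existsP[i /negPf lam_f].
  by rewrite (bigD1 i) //= /step_wt lam_f !mul0r.
rewrite (eq_bigl (fun p => fits m (step_shape p.1) p.2 && interlacing lam p.1)).
  by apply: eq_bigr => -[f T] /= /andP[fitT lam_f]; rewrite rfill_wt_glue.
move=> [f T] /=; apply/andP/andP => [[fitG /eqP cutG]|[fitT lam_f]].
  by have := cut_interlacing lam_dec fitG le_lamC lam0; have := cut_fits fitG;
     rewrite -[restr _]/(cut (glue lam (f, T))).2 cutG.
by rewrite glue_fits // glueK.
Qed.

End Tableaux.

(** * The tableau sum as a determinant *)

Section SvtSumDet.
Set Implicit Arguments.
Unset Strict Implicit.
Import GRing.Theory.
Local Open Scope ring_scope.
Variables (A : comNzRingType) (x t : nat -> A) (N C : nat).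

Lemma lreg_prod (I : finType) (P : pred I) (F : I -> A) :
  (forall i, P i -> GRing.lreg (F i)) -> GRing.lreg (\prod_(i | P i) F i).
Proof.
move=> Freg; apply: big_ind Freg => [|y z]; first exact: lreg1.
exact: lregM.
Qed.

(** Without entries only the empty shape has a tableau, and its matrix is the identity; for any
    other shape the matrix has a zero row. *)
Lemma svt_sum0 (lam : nat -> nat) : (forall i, (lam i <= C)%N) ->
  svt_sum x t N C 0 lam = \det (jtmx x t N 0 lam).
Proof.
move=> le_lamC; have [/forallP lam0|] := boolP [forall i : 'I_N, lam i == 0%N].
  have -> : jtmx x t N 0 lam = 1%:M.
    by apply/matrixP => i j; rewrite !mxE lam0 andbT.
  rewrite det1 /svt_sum (big_pred1 [ffun=> set0]) => [|T].
    by rewrite /rfill_wt big1 // => b _; rewrite ffunE /box_wt cards0 big_set0 mulr1.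
  apply/fitsP/eqP => [[shT boundT _ _]|->].
    apply/ffunP => -[i j]; rewrite ffunE; apply/eqP; rewrite -[_ == _]negbK shT.
    by rewrite (eqP (lam0 i)).
  by split=> [i j|i j a|i j j' a b _|i i' j a b _]; rewrite !ffunE ?inE // eqxx (eqP (lam0 i)).
rewrite negb_forall => /existsP[i lami].
rewrite (@row0_det _ _ _ i) => [|j]; last by rewrite mxE ltn0 (negPf lami) andbF.
rewrite /svt_sum big_pred0 // => T; apply/negbTE/negP => /fitsP[shT boundT _ _].
have lt_0C : (0 < C)%N by rewrite (leq_trans _ (le_lamC i)) // lt0n.
have : T (i, Ordinal lt_0C) != set0 by rewrite shT /= lt0n.
by case/set0Pn => a /boundT.
Qed.

Lemma svt_sum_det m (lam : nat -> nat) : (m <= N)%N ->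
  (forall i k : nat, (i < N)%N -> (k < N)%N -> GRing.lreg (1 - t i * x k)) ->
  (forall i, (lam i.+1 <= lam i)%N) -> (forall i, (lam i <= C)%N) ->
  (forall i, (N <= i)%N -> lam i = 0%N) ->
  svt_sum x t N C m lam = \det (jtmx x t N m lam).
Proof.
move=> le_mN reg; elim: m le_mN lam => [|m IHm] lt_mN lam lam_dec le_lamC lam0.
  exact: svt_sum0.
have dreg : GRing.lreg (\prod_(i < m) (1 - t i * x m)).
  by apply: lreg_prod => i _; apply: reg => //; apply: ltn_trans (ltn_ord i) lt_mN.
(* Both sides obey the same recursion up to a regular factor, which is cancelled. *)
rewrite (svt_sum_rec x t lt_mN) //; apply: dreg; rewrite -(@jtmx_rec A x t N C) //.
congr (_ * _); apply: eq_bigr => f _.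
have [/forallP lam_f|] := boolP (interlacing lam f); last first.
  rewrite negb_forall => /existsP[i /negPf lam_f].
  by rewrite (bigD1 i) //= /step_wt lam_f !mul0r.
congr (_ * _); apply: IHm; first exact: ltnW.
(* The inner shape is again a partition: [lam i.+1] separates its rows [i] and [i + 1]. *)
- move=> i; have [lt_i1N|le_Ni1] := ltnP i.+1 N; last first.
    by rewrite {1}/step_shape insubF // ltnNge le_Ni1.
  rewrite -[i]/(val (Ordinal (ltnW lt_i1N))) -[i.+1]/(val (Ordinal lt_i1N)) !step_shapeE.
  have /andP[_ le_f] := lam_f (Ordinal lt_i1N).
  apply: leq_trans le_f _; have /andP[le_f _] := lam_f (Ordinal (ltnW lt_i1N)).
  by apply: leq_trans le_f; apply: leq_addr.
- by move=> i; rewrite /step_shape; case: insub => // i'; rewrite -ltnS.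
- by move=> i le_Ni; rewrite /step_shape insubF // ltnNge le_Ni.
Qed.

End SvtSumDet.

(** * Comparison with elementary and complete homogeneous polynomials *)

Section SymmetricFunctions.
Set Implicit Arguments.
Unset Strict Implicit.
Import GRing.Theory.
Local Open Scope ring_scope.

Lemma coef_tpoly (A : comNzRingType) (t : nat -> A) i k :
  (tpoly t i)`_k = \sum_(J : {set 'I_i} | #|J| == k) \prod_(l in J) - t l.
Proof.
rewrite /tpoly; under eq_bigr do rewrite addrC.
rewrite bigA_distr coef_sum [RHS]big_mkcond; apply: eq_big => // J _.
rewrite -big_mkcond scaler_prod prodr_const coefZ coefXn eq_sym.
by case: eqP => _; rewrite ?mulr1 ?mulr0.
Qed.

Lemma comp_mesym (R : comNzRingType) n p (c : p.-tuple {mpoly R[n]}) k :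
  mesym p R k \mPo c = \sum_(J : {set 'I_p} | #|J| == k) \prod_(l in J) tnth c l.
Proof.
rewrite /mesym rmorph_sum; apply: eq_bigr => J _; rewrite rmorph_prod.
by apply: eq_bigr => l _; rewrite /= comp_mpolyXU -tnth_nth.
Qed.

(** Both sides are the coefficient of degree [K] in a product of geometric series, which may be
    truncated after degree [K]. *)
Lemma chsymE (A : comNzRingType) (x : nat -> A) m K :
  chsym x m K = \sum_(f : {ffun 'I_m -> 'I_K.+1} | (\sum_(l < m) f l == K)%N)
    \prod_(l < m) x l ^+ f l.
Proof.
pose P m' : {poly A} := \prod_(l < m') \poly_(a < K.+1) (x l ^+ a).
have PE m' k : (k <= K)%N -> (P m')`_k = chsym x m' k.
  elim: m' k => [|m' IHm] k le_kK; first by rewrite /P big_ord0 coef1.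
  rewrite /P big_ord_recr coefMr; apply: eq_bigr => a _.
  rewrite coef_poly (leq_trans (ltn_ord a)) // mulrC IHm //.
  exact: leq_trans (leq_subr _ _) le_kK.
rewrite -PE // /P; under eq_bigr do rewrite poly_def.
rewrite bigA_distr_bigA coef_sum [RHS]big_mkcond; apply: eq_bigr => f _ /=.
rewrite scaler_prod prodrXr coefZ coefXn eq_sym.
by case: eqP => _; rewrite ?mulr1 ?mulr0.
Qed.

Lemma comp_hsym (R : comNzRingType) n p (c : p.-tuple {mpoly R[n]}) (x : nat -> {mpoly R[n]}) k :
  (forall l, tnth c l = x l) -> hsym R p k \mPo c = chsym x p k.
Proof.
move=> cE; rewrite /hsym rmorph_sum chsymE.
pose h (a : 'X_{1..p < k.+1}) : {ffun 'I_p -> 'I_k.+1} := [ffun l => inord (bmnm a l)].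
have bm0_bound : (mdeg (0%MM : 'X_{1..p}) < k.+1)%N by rewrite mdeg0.
(* The default of [insubd] never matters, since only exponents of total degree [k] are summed. *)
pose h' (f : {ffun 'I_p -> 'I_k.+1}) : 'X_{1..p < k.+1} :=
  insubd (BMultinom bm0_bound) [multinom (f l : nat) | l < p].
have hE a l : h a l = bmnm a l :> nat.
  rewrite ffunE inordK //; apply: leq_ltn_trans (bmdeg a).
  by rewrite mdegE (bigD1 l) //= leq_addr.
rewrite [RHS](reindex_onto h h') => [|f /eqP fk].
  apply: eq_big => [a|a _]; last first.
    by rewrite /= comp_mpolyX; apply: eq_bigr => l _; rewrite cE hE.
  under eq_bigr do rewrite hE; rewrite mdegE (_ : h' (h a) = a) ?eqxx ?andbT //.
  apply: val_inj => /=; rewrite val_insubd; case: ifP => [_|].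
    by apply/mnmP => l; rewrite mnmE hE.
  rewrite mdegE; under eq_bigr do rewrite mnmE hE.
  by rewrite -mdegE bmdeg.
apply/ffunP => l; apply: val_inj; rewrite /= hE val_insubd.
rewrite mdegE (eq_bigr (fun l => f l : nat)) ?fk ?ltnSn ?mnmE // => l' _.
by rewrite mnmE.
Qed.

End SymmetricFunctions.

(** * The refined Grothendieck polynomial as a tableau sum in a rectangle *)

Section Grothendieck.
Set Implicit Arguments.
Unset Strict Implicit.
Import GRing.Theory.
Local Open Scope ring_scope.
Variable (R : comNzRingType) (n : nat).

Definition xseq (k : nat) : {mpoly R[n + n]} := oapp (@xvar R n) 0 (insub k).
Definition tseq (k : nat) : {mpoly R[n + n]} := oapp (@tvar R n) 0 (insub k).

Lemma xseqE (k : 'I_n) : xseq k = xvar R k. Proof. by rewrite /xseq valK. Qed.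
Lemma tseqE (k : 'I_n) : tseq k = tvar R k. Proof. by rewrite /tseq valK. Qed.

(** The leading monomial is [t_i x_k] with coefficient -1, and a polynomial with regular leading
    coefficient is regular over any [R]. *)
Lemma lreg_1subtx i k : (i < n)%N -> (k < n)%N -> GRing.lreg (1 - tseq i * xseq k).
Proof.
move=> lt_in lt_kn; rewrite -[i]/(val (Ordinal lt_in)) -[k]/(val (Ordinal lt_kn)).
rewrite tseqE xseqE /tvar /xvar -mpolyXD; set m := (_ + _)%MM.
have m0 : m != 0%MM.
  apply/eqP => /mnmP/(_ (lshift n (Ordinal lt_kn))).
  by rewrite mnmDE !mnm1E mnm0E eqxx addn1.
have mleadE : mlead (1 - 'X_[m] : {mpoly R[n + n]}) = m.
  by rewrite mleadDr mleadN mleadXm // mlead1 Order.POrderTheory.lt_neqAle eq_sym m0 le0m.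
apply: lreg_mleadc; rewrite mleadE mcoeffB mcoeff1 mcoeffX eqxx (negPf m0) sub0r.
exact/lregN/lreg1.
Qed.

Section Shape.
Variables (lam : 'I_n -> nat) (C : nat).
Hypothesis le_lamC : forall i, (lam i <= C)%N.

Definition lamseq (i : nat) : nat := oapp lam 0%N (insub i).

Lemma lamseqE (i : 'I_n) : lamseq i = lam i. Proof. by rewrite /lamseq valK. Qed.

Lemma smax_le (S : {set 'I_n}) k :
  reflect (forall a, a \in S -> (a <= k)%N) (smax S <= k)%N.
Proof. exact: bigmax_leqP. Qed.

Lemma smax_mem (S : {set 'I_n}) : S != set0 -> exists2 a, a \in S & smax S = a.
Proof.
by rewrite -card_gt0 => /(eq_bigmax_cond (fun a : 'I_n => val a))[a aS maxE]; exists a.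
Qed.

(** The bound on [k] accounts for the default [n] of an empty minimum. *)
Lemma le_smin (S : {set 'I_n}) k : (k <= n)%N ->
  reflect (forall a, a \in S -> (k <= a)%N) (k <= smin S)%N.
Proof.
move=> le_kn; apply: (iffP idP) => [le_k a aS|le_k].
  apply: leq_trans le_k _; rewrite /smin; have := mem_index_enum a.
  elim: (index_enum _) => // b r IHr; rewrite big_cons inE.
  case/predU1P => [<-|/IHr le_r]; first by rewrite aS geq_minl.
  by case: ifP => // _; rewrite geq_min le_r orbT.
by apply: (big_ind (fun l => k <= l)%N) => // a b; rewrite leq_min => -> ->.
Qed.

Lemma smax_le_smin (S S' : {set 'I_n}) : S != set0 ->
  (smax S <= smin S')%N <-> (forall a b, a \in S -> b \in S' -> (a <= b)%N).
Proof.
case/smax_mem => a0 a0S maxS.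
have le_n : (smax S <= n)%N by rewrite maxS ltnW.
split=> [/(le_smin _ le_n) le a b aS bS|le]; last first.
  by apply/(le_smin _ le_n) => b bS; rewrite maxS le.
by apply: leq_trans (le b bS); move: a aS; apply/smax_le.
Qed.

Lemma smax_lt_smin (S S' : {set 'I_n}) : S != set0 ->
  (smax S < smin S')%N <-> (forall a b, a \in S -> b \in S' -> (a < b)%N).
Proof.
case/smax_mem => a0 a0S maxS.
have lt_n : (smax S < n)%N by rewrite maxS.
split=> [/(le_smin _ lt_n) lt a b aS bS|lt]; last first.
  by apply/(le_smin _ lt_n) => b bS; rewrite maxS lt.
by apply: leq_ltn_trans (lt b bS); move: a aS; apply/smax_le.
Qed.

Definition spread (T : filling lam) : rfilling n C :=
  [ffun b : 'I_n * 'I_C =>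
     if insub (b.2 : nat) is Some j then T (Tagged _ (j : 'I_(lam b.1))) else set0].

Definition unspread (T : rfilling n C) : filling lam :=
  [ffun b => T (tag b, widen_ord (le_lamC (tag b)) (tagged b))].

Lemma spread_in T i (j : 'I_C) (lt_j : (j < lam i)%N) :
  spread T (i, j) = T (Tagged _ (Ordinal lt_j)).
Proof. by rewrite ffunE /= insubT. Qed.

Lemma spread_out T i (j : 'I_C) : (lam i <= j)%N -> spread T (i, j) = set0.
Proof. by rewrite leqNgt => nlt; rewrite ffunE /= insubN. Qed.

Lemma spreadK T : unspread (spread T) = T.
Proof.
apply/ffunP => -[i j]; rewrite ffunE /= spread_in /= ?ltn_ord // => lt_j.
by congr (T (Tagged _ _)); apply: val_inj.
Qed.

Lemma unspreadK T : fits n lamseq T -> spread (unspread T) = T.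
Proof.
case/fitsP => shT _ _ _; apply/ffunP => -[i j].
have [le_lamj|lt_j] := leqP (lam i) j.
  rewrite spread_out //; apply/esym/eqP; rewrite -[_ == _]negbK shT lamseqE.
  by rewrite -leqNgt.
by rewrite spread_in ffunE /=; congr (T (_, _)); apply: val_inj.
Qed.

Lemma fits_spread T : fits n lamseq (spread T) = is_svt T.
Proof.
pose wd i (j : 'I_(lam i)) : 'I_C := widen_ord (le_lamC i) j.
have TE i j : T (existT _ i j) = spread T (i, wd i j).
  rewrite spread_in /= ?ltn_ord // => lt_j.
  by congr (T (Tagged _ _)); apply: val_inj.
have spread_mem i j a : a \in spread T (i, j) -> (j < lam i)%N.
  by case: ltnP => // /spread_out->; rewrite inE.
apply/fitsP/and3P => [[shT _ rowT colT]|[neT rowT colT]].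
  have ne b : T b != set0 by case: b => i j; rewrite TE shT lamseqE /= ltn_ord.
  split; first exact/forallP.
    apply/forallP => -[i j]; apply/forallP => -[i' j']; apply/implyP.
    rewrite /brow /bcol /= => /andP[/eqP/val_inj ii' /eqP jj']; subst i'.
    apply/smax_le_smin => // a b; rewrite !TE; exact: rowT.
  apply/forallP => -[i j]; apply/forallP => -[i' j']; apply/implyP.
  rewrite /brow /bcol /= => /andP[/eqP jj' /eqP ii'].
  apply/smax_lt_smin => // a b; rewrite !TE.
  have -> : wd i' j' = wd i j by apply: val_inj.
  exact: colT.
have ne b : T b != set0 := forallP neT b.
split=> [i j|i j a _|i j j' a b jj' aT bT|i i' j a b ii' aT bT].
- rewrite lamseqE; have [le_lamj|lt_j] := leqP (lam i) j.
    by rewrite spread_out // eqxx.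
  by rewrite spread_in ne.
- exact: ltn_ord.
- have lt_j := spread_mem _ _ _ aT; have lt_j' := spread_mem _ _ _ bT.
  move: aT bT; rewrite !spread_in => aT bT.
  have := forallP (forallP rowT (Tagged _ (Ordinal lt_j))) (Tagged _ (Ordinal lt_j')).
  by rewrite /brow /bcol /= (introT eqP jj') eqxx /= => /(smax_le_smin _ (ne _))/(_ a b aT bT).
have lt_j := spread_mem _ _ _ aT; have lt_j' := spread_mem _ _ _ bT.
move: aT bT; rewrite !spread_in => aT bT.
have := forallP (forallP colT (Tagged _ (Ordinal lt_j))) (Tagged _ (Ordinal lt_j')).
by rewrite /brow /bcol /= (introT eqP ii') eqxx /= => /(smax_lt_smin _ (ne _))/(_ a b aT bT).
Qed.

Lemma rfill_wt_spread T : rfill_wt xseq tseq (spread T) =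
  \prod_(b : box lam) box_wt xseq tseq (tag b) (T b).
Proof.
transitivity (\prod_(i < n) \prod_(j < C) box_wt xseq tseq i (spread T (i, j))).
  by rewrite pair_big; apply: eq_bigr => -[].
transitivity (\prod_(i < n) \prod_(j < lam i) box_wt xseq tseq i (T (Tagged _ j))).
  apply: eq_bigr => i _.
  (* The weights of the row are extended by 1 up to column [C], matching the empty boxes of
     [spread T]. *)
  pose g (j : nat) : {mpoly R[n + n]} := if insub j is Some j'
    then box_wt xseq tseq i (T (Tagged _ (j' : 'I_(lam i)))) else 1.
  rewrite [RHS](eq_bigr (fun j : 'I_(lam i) => g j)); last by move=> j _; rewrite /g valK.
  rewrite (big_ord_widen C g) // [RHS]big_mkcond; apply: eq_bigr => j _.
  have [lt_j|le_j] := ltnP j (lam i); first by rewrite spread_in /g insubT.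
  by rewrite spread_out // /box_wt cards0 big_set0 mulr1.
rewrite (sig_big_dep xpredT (fun _ => xpredT)
  (fun (i : 'I_n) (j : 'I_(lam i)) => box_wt xseq tseq i (T (Tagged _ j)))) /=.
by apply: eq_bigr => -[].
Qed.

(** The powers of [t] are grouped by rows, where non-emptiness makes the numbers [#|T b| - 1] add up
    to [extra]; those of [x] come from exchanging the products over boxes and entries. *)
Lemma svt_weight T : is_svt T ->
  (\prod_(i < n) (- tvar R i) ^+ extra T i) * \prod_(k < n) xvar R k ^+ occ T k =
  rfill_wt xseq tseq (spread T).
Proof.
case/and3P => /forallP neT _ _; rewrite rfill_wt_spread big_split /=; congr (_ * _).
  rewrite (partition_big (fun b : box lam => tag b) xpredT) //=; apply: eq_bigr => i _.
  rewrite (eq_bigr (fun b => (- tseq i) ^+ #|T b|.-1)); last by move=> b /eqP->.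
  rewrite prodrXr tseqE; congr (_ ^+ _); rewrite /extra.
  have -> : lam i = (\sum_(b : box lam | tag b == i) 1)%N.
    transitivity (\sum_(i' | i' == i) \sum_(j < lam i') 1)%N.
      by rewrite big_pred1_eq sum1_card card_ord.
    by rewrite sig_big_dep; apply: eq_bigl => b; rewrite andbT.
  rewrite [X in (X - _)%N](eq_bigr (fun b => #|T b|.-1 + 1)%N) => [|b _].
    by rewrite big_split /= addnK.
  by rewrite addn1 prednK // card_gt0.
rewrite (eq_bigr (fun b => \prod_(k < n) (if k \in T b then xseq k else 1))); last first.
  by move=> b _; rewrite big_mkcond.
rewrite exchange_big; apply: eq_bigr => k _.
by rewrite -big_mkcond prodr_const xseqE.
Qed.

Lemma refined_grothendieckE : refined_grothendieck R lam = svt_sum xseq tseq n C n lamseq.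
Proof.
rewrite /svt_sum (reindex_onto spread unspread) => [|T]; last exact: unspreadK.
apply: eq_big => [T|T]; first by rewrite fits_spread spreadK eqxx andbT.
exact: svt_weight.
Qed.

End Shape.

Lemma etE (i : 'I_n) k : et R i k%:Z = (tpoly tseq i)`_k.
Proof.
rewrite /et /= comp_mesym coef_tpoly; apply: eq_bigr => J _; apply: eq_bigr => l _.
by rewrite tnth_mktuple -tseqE.
Qed.

Lemma et_neg (i : 'I_n) z : (z < 0)%R -> et R i z = 0.
Proof. by case: z => // k _; rewrite /et /= comp_mpoly0. Qed.

Lemma size_tpoly i : (size (tpoly tseq i) <= i.+1)%N.
Proof.
elim: i => [|i IHi]; first by rewrite /tpoly big_ord0 size_poly1.
rewrite /tpoly big_ord_recr; apply: leq_trans (size_polyMleq _ _) _ => /=.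
set q := _ + _; have szq : (size q <= 2)%N.
  rewrite (leq_trans (size_polyD _ _)) // geq_max (leq_trans (size_polyC_leq1 _)) //=.
  by rewrite (leq_trans (size_scale_leq _ _)) // size_polyX.
by rewrite -subn1 leq_subLR (leq_trans (leq_add IHi szq)) // addn2.
Qed.

Lemma hxE z : hx R n z = chsymz xseq n z.
Proof.
case: z => k; rewrite /hx /=; last by rewrite comp_mpoly0.
by rewrite (comp_hsym (x := xseq)) // => l; rewrite tnth_mktuple xseqE.
Qed.

Lemma hx_neg z : (z < 0)%R -> hx R n z = 0.
Proof. by rewrite hxE; apply: chsymz_neg. Qed.

Lemma rsym_sum (i : 'I_n) z M : (i < M)%N ->
  rsym xseq tseq i n z = \sum_(k < M) et R i k%:Z * hx R n (k%:Z + z).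
Proof.
move=> lt_iM; rewrite /rsym (@pact_widen _ _ _ _ M); last exact: leq_trans (size_tpoly i) _.
by apply: eq_bigr => k _; rewrite etE hxE addrC.
Qed.

Lemma sum_shift (V : zmodType) (F : nat -> V) a M : (forall k, (k < a)%N -> F k = 0) ->
  \sum_(k < a + M) F k = \sum_(k < M) F (a + k)%N.
Proof.
by move=> F0; rewrite big_split_ord /= big1 ?add0r // => k _; rewrite F0 /=.
Qed.

(** The summation index is shifted by [c]. The terms gained or lost vanish, through a negative index
    of [e] if [c >= 0] and of [h] if [c < 0]. *)
Lemma sum_et_hx_shift (i : 'I_n) c : exists M0, forall M, (M0 <= M)%N ->
  \sum_(k < M) et R i (k%:Z - c) * hx R n k%:Z = rsym xseq tseq i n c.
Proof.
case: (Num.Theory.lerP 0 c) => [c0|c0].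
  exists (`|c| + i.+1)%N => M le_M; rewrite (_ : M = `|c| + (M - `|c|))%N; last by lia.
  rewrite (sum_shift (F := fun k => et R i (k%:Z - c) * hx R n k%:Z)) => [|k lt_k]; last first.
    by rewrite et_neg ?mul0r //; lia.
  rewrite (@rsym_sum _ _ (M - `|c|)); last by lia.
  by apply: eq_bigr => k _; congr (et R i _ * hx R n _); lia.
exists i.+1 => M le_M; rewrite (@rsym_sum _ _ (`|c| + M)); last by lia.
rewrite (sum_shift (F := fun k => et R i k%:Z * hx R n (k%:Z + c))) => [|k lt_k]; last first.
  by rewrite hx_neg ?mulr0 //; lia.
by apply: eq_bigr => k _; congr (et R i _ * hx R n _); lia.
Qed.

End Grothendieck.

(* Sums over all natural numbers and the two determinants *)
From mathcomp Require Import classical_sets fsbigop.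
Local Open Scope ring_scope.

(** Partial sums that are constant from [M0] on force the terms from [M0] on to vanish. *)
Lemma fsum_nat_eq (V : zmodType) (F : nat -> V) (v : V) M0 :
  (forall M, (M0 <= M)%N -> \sum_(k < M) F k = v) ->
  \sum_(k \in [set: nat]%classic) F k = v.
Proof.
move=> sumF; have F0 k : (M0 <= k)%N -> F k = 0.
  move=> le_M0k; have := sumF k.+1 (leqW le_M0k).
  by rewrite big_ord_recr /= sumF // => /(canRL (GRing.addKr _)); rewrite GRing.addNr.
rewrite -(@fsbig_widen _ _ _ _ (`I_M0)%classic) => [|//|k /= [_ nk]]; last first.
  by apply: F0; rewrite leqNgt; apply/negP.
by rewrite -fsbig_ord; apply: sumF.
Qed.

(* [\sum_(k \in setT)] is the sum over all k : nat of a finitely supported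
   family; in every matrix entry below only finitely many terms are nonzero. *)
Theorem theorem5p12 (R : comNzRingType) (n : nat) (lam : 'I_n -> nat)
    (lam_noninc : forall i j : 'I_n, (i <= j)%N -> (lam j <= lam i)%N) :
  refined_grothendieck R lam =
    \det (\matrix_(i < n, j < n)
            \sum_(k \in [set: nat]%classic)
              et R i (k%:Z - (lam i)%:Z + i%:Z - j%:Z) * hx R n k%:Z)
  /\
  refined_grothendieck R lam =
    \det (\matrix_(i < n, j < n)
            \sum_(k \in [set: nat]%classic)
              et R i k%:Z * hx R n (k%:Z + (lam i)%:Z - i%:Z + j%:Z)).
Proof.
have lamC i : (lam i <= \max_i lam i)%N by apply: leq_bigmax.
(* With as many variables as rows, [jtmx] has no padding rows left. *)
have -> : refined_grothendieck R lam = \det (\matrix_(i < n, j < n)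
    rsym (xseq R n) (tseq R n) i n ((lam i)%:Z - i%:Z + j%:Z)).
  rewrite (@refined_grothendieckE R n lam _ lamC) svt_sum_det //.
  - by congr (\det _); apply/matrixP => i j; rewrite !mxE ltn_ord lamseqE.
  - exact: lreg_1subtx.
  - move=> i; rewrite /lamseq; case: insubP => //= j _ ji.
    have lt_in : (i < n)%N by rewrite ltnW // -ji.
    by rewrite insubT /= lam_noninc //= ji.
  - by move=> i; rewrite /lamseq; case: insubP => //=.
  - by move=> i le_ni; rewrite /lamseq insubF //= ltnNge le_ni.
split; congr (\det _); apply/matrixP => i j; rewrite !mxE; symmetry.
  have [M0 sumE] := @sum_et_hx_shift R n i ((lam i)%:Z - i%:Z + j%:Z).
  apply: (@fsum_nat_eq _ _ _ M0) => M le_M; rewrite -(sumE M le_M).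
  by apply: eq_bigr => k _; congr (et R i _ * _); lia.
(* Row [i] involves [e_k] in [i] variables, which vanishes for [k > i]. *)
apply: (@fsum_nat_eq _ _ _ i.+1) => M le_M; rewrite (@rsym_sum R n i _ M le_M).
by apply: eq_bigr => k _; congr (_ * hx R n _); lia.
Qed.
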